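(* Let $m\ge 3$ be an odd integer, let $\beta$ be a primitive 3rd root of unity in $\mathbb{F}_{2^{2m}}$, and let $v\in\mathbb{F}_{2^{2m}}^*$ satisfy $\mathrm{tr}_m^{2m}(\beta v)=0$ or $\mathrm{tr}_m^{2m}(\beta^2 v)=0$. Then the monomial $v\,x^{(2^{2m+1}-2^{m+1}+1)/5}$ (if $m\equiv 1\pmod 4$), respectively $v\,x^{(2^{2m}-2^{m+1}+2)/5}$ (if $m\equiv 3\pmod 4$), is a complete permutation polynomial over $\mathbb{F}_{2^{2m}}$.
   Context: A polynomial $f\in\mathbb{F}_Q[x]$ is a complete permutation polynomial over $\mathbb{F}_Q$ if both $f(x)$ and $f(x)+x$ induce bijections of $\mathbb{F}_Q$. $\mathrm{tr}_m^{2m}(x)=x+x^{2^m}$ is the relative trace from $\mathbb{F}_{2^{2m}}$ to $\mathbb{F}_{2^m}$. *)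

(* Defs.v *)
From mathcomp Require Import all_boot all_order all_algebra all_field.

Set Implicit Arguments.
Unset Strict Implicit.
Unset Printing Implicit Defensive.

Import GRing.Theory.
Local Open Scope ring_scope.

Definition complete_permutation_poly (F : finFieldType) (f : {poly F}) : Prop :=
  bijective (fun x : F => f.[x]) /\ bijective (fun x : F => f.[x] + x).

(* When #|F| = 2 ^ (2 * m), the subfield with 2 ^ m elements is the fixed field
   of x |-> x ^+ (2 ^ m), so this is the relative trace onto that subfield, with
   values viewed in F. *)
Definition rel_trace (F : finFieldType) (m : nat) (x : F) : F :=
  x + x ^+ (2 ^ m)%N.

(* Main.v *)
Require Import Defs.
From mathcomp Require Import all_boot all_order all_algebra all_field.
From mathcomp Require Import ring zify.

Set Implicit Arguments.
Unset Strict Implicit.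
Unset Printing Implicit Defensive.

Import GRing.Theory.
Local Open Scope ring_scope.

(** Put q = 2^m and write x' = x^q. As 5 is coprime to q^2 - 1, we may
    substitute x = y^5; both exponents d then satisfy y^(5d) y'^2 = y^3, so
    v x^d + x becomes G(y) = y^5 (v + N^2) / N^2 with N = y y'. If g is the cube
    root of unity for which w = g v lies in F_q, then
    G(y) G(y)' = N^5 - w N^3 + w^2 N, a Dickson polynomial in N. This polynomial
    is injective on F_q, so G(y) determines N, then y^5, then y. *)

(** A Bezout relation a * k = b * (#|F| - 1) + 1 makes the a-th power a left inverse, and z ^+ (b *
    (#|F| - 1) + 1) = z holds at z = 0 too. *)
Lemma finField_exp_inj (F : finFieldType) (k : nat) :
  (0 < k)%N -> coprime k #|F|.-1 -> injective (fun x : F => x ^+ k).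
Proof.
move=> k_gt0 cop x y /= exy.
have [a b eab _] := egcdnP #|F|.-1 k_gt0.
have powE (z : F) : z ^+ (b * #|F|.-1 + 1) = z.
  elim: b {eab} => [|b IHb]; first by rewrite expr1.
  rewrite mulSn -addnA exprD IHb -exprSr prednK ?expf_card //.
  by rewrite ltnW // card_finNzRing_gt1.
move: cop; rewrite /coprime => /eqP cop.
rewrite -(powE x) -(powE y); move: eab; rewrite cop => <-.
by rewrite mulnC !exprM exy.
Qed.

(** Subtracting the relation from its image under [phi] leaves (phi g - g) * b = 0. *)
Lemma fixed_free (F : fieldType) (phi : {rmorphism F -> F}) (g a b : F) :
  phi g != g -> phi a = a -> phi b = b -> a + g * b = 0 -> a = 0 /\ b = 0.
Proof.
move=> g_nfix fa fb eab.
have: phi (a + g * b) = 0 by rewrite eab rmorph0.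
rewrite rmorphD rmorphM fa fb => eab'.
have: (phi g - g) * b = 0.
  by rewrite -[RHS](subrr 0) -{1}eab' -eab; ring.
move/eqP; rewrite mulf_eq0 subr_eq0 (negPf g_nfix) => /eqP b0.
by move: eab; rewrite b0 mulr0 addr0.
Qed.

(** With g^2 = -(g + 1) the factor reads ((a + b)^2 - w) + g (a b - w), so both brackets vanish.
    Then a^2 + a b + b^2 = (a - g b)(a - g^2 b) is 0, and independence applied once more forces b =
    0. *)
Lemma dickson5_factor_eq0 (F : fieldType) (phi : {rmorphism F -> F})
    (g w a b : F) :
  g ^+ 2 + g + 1 = 0 -> phi g != g -> phi (g ^+ 2) != g ^+ 2 ->
  phi w = w -> phi a = a -> phi b = b ->
  (a + b) ^+ 2 + g * (a * b) + g ^+ 2 * w = 0 -> w = 0.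
Proof.
move=> eg g_nfix g2_nfix fw fa fb e0.
have [||||/subr0_eq eS /subr0_eq eP] :=
    @fixed_free F phi g ((a + b) ^+ 2 - w) (a * b - w) => //.
- by rewrite rmorphB rmorphXn rmorphD fa fb fw.
- by rewrite rmorphB rmorphM fa fb fw.
- rewrite -[RHS]e0; have -> : g ^+ 2 = - (g + 1) by apply/eqP; rewrite -addr_eq0 addrA eg.
  ring.
suff b0 : b = 0 by rewrite -eP b0 mulr0.
have: (a - g * b) * (a - g ^+ 2 * b) = 0.
  transitivity ((a + b) ^+ 2 - a * b - (g ^+ 2 + g + 1) * (a * b - (g - 1) * b ^+ 2)).
    ring.
  by rewrite eS eP eg mul0r subrr subr0.
have nb : phi (- b) = - b by rewrite rmorphN fb.
move/eqP; rewrite mulf_eq0 -!mulrN => /orP[] /eqP.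
  by case/(fixed_free g_nfix fa nb) => _ /eqP; rewrite oppr_eq0 => /eqP.
by case/(fixed_free g2_nfix fa nb) => _ /eqP; rewrite oppr_eq0 => /eqP.
Qed.

(* In characteristic 2, (D(a) - D(b)) / (a - b) is the norm form
   S^2 + P^2 + w^2 - S P - S w - P w in S = (a + b)^2, P = a b and w, which
   splits over the cube roots of unity; as 1, g are independent over the fixed
   field of phi, neither factor vanishes unless S = P = w. *)
Lemma dickson5_inj (F : fieldType) (phi : {rmorphism F -> F}) (g w a b : F) :
  2%:R = 0 :> F -> g ^+ 2 + g + 1 = 0 -> phi g = g ^+ 2 ->
  w != 0 -> phi w = w -> phi a = a -> phi b = b ->
  a ^+ 5 - w * a ^+ 3 + w ^+ 2 * a = b ^+ 5 - w * b ^+ 3 + w ^+ 2 * b -> a = b.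
Proof.
move=> two0 eg fg w0 fw fa fb eD.
have g4 : (g ^+ 2) ^+ 2 = g.
  transitivity (g + (g ^+ 2 + g + 1) * (g ^+ 2 - g)); first ring.
  by rewrite eg mul0r addr0.
have eg2 : (g ^+ 2) ^+ 2 + g ^+ 2 + 1 = 0 by rewrite g4 -eg; ring.
have g_nfix : g ^+ 2 != g.
  apply/eqP => e; have := eg; rewrite e -mulr2n -mulr_natl two0 mul0r add0r.
  exact/eqP/oner_neq0.
have fg2 : phi (g ^+ 2) = g by rewrite rmorphXn fg g4.
apply/subr0_eq/eqP/negPn/negP => ab0; case/eqP: w0.
set A := (a + b) ^+ 2 + g * (a * b) + g ^+ 2 * w.
set B := (a + b) ^+ 2 + g ^+ 2 * (a * b) + (g ^+ 2) ^+ 2 * w.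
have ABE : A * B = (a + b) ^+ 4 + (a * b) ^+ 2 + w ^+ 2
    - (a + b) ^+ 2 * (a * b) - (a + b) ^+ 2 * w - a * b * w.
  have gE : g ^+ 2 = - (g + 1) by apply/eqP; rewrite -addr_eq0 addrA eg.
  transitivity (((a + b) ^+ 2 + g * (a * b) - (g + 1) * w)
    * ((a + b) ^+ 2 - (g + 1) * (a * b) + g * w)).
    by rewrite /A /B g4 gE; ring.
  apply/subr0_eq; transitivity (- (g ^+ 2 + g + 1) * (a * b - w) ^+ 2); first ring.
  by rewrite eg oppr0 mul0r.
have /eqP : A * B = 0.
  apply: (mulfI ab0); rewrite mulr0 ABE.
  (* The factorisation holds only modulo 2; the last summand is the correction. *)
  transitivity ((a ^+ 5 - w * a ^+ 3 + w ^+ 2 * a)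
                - (b ^+ 5 - w * b ^+ 3 + w ^+ 2 * b)
                + 2%:R * ((a - b) * ((a + b) ^+ 2 * (a * b) - w * (a * b)))).
    by ring.
  by rewrite eD subrr two0 mul0r addr0.
rewrite mulf_eq0 => /orP[] /eqP.
  by apply: (@dickson5_factor_eq0 F phi); rewrite ?fg ?fg2 // eq_sym.
(* [B] is [A] with g^2 in place of g. *)
by apply: (@dickson5_factor_eq0 F phi); rewrite ?eg2 ?g4 ?fg ?fg2 // eq_sym.
Qed.

(* The elements e and f below stand for y^(5d) and z^(5d). *)
Section Substituted.

Variables (F : fieldType) (phi : {rmorphism F -> F}) (g v : F).
Hypotheses (phiK : involutive phi) (two0 : 2%:R = 0 :> F).
Hypotheses (eg : g ^+ 2 + g + 1 = 0) (fg : phi g = g ^+ 2).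
Hypotheses (v0 : v != 0) (fgv : phi (g * v) = g * v).

Let norm (y : F) := y * phi y.

Let norm_fix y : phi (norm y) = norm y.
Proof. by rewrite /norm rmorphM phiK mulrC. Qed.

Let norm_eq0 y : (norm y == 0) = (y == 0).
Proof. by rewrite /norm mulf_eq0 fmorph_eq0 orbb. Qed.

Let g3 : g ^+ 3 = 1.
Proof.
transitivity (1 + (g ^+ 2 + g + 1) * (g - 1)); first ring.
by rewrite eg mul0r addr0.
Qed.

Let g0 : g != 0.
Proof. by apply/eqP => e; have /eqP := g3; rewrite e expr0n eq_sym oner_eq0. Qed.

Let phi_v : phi v = g ^+ 2 * v.
Proof.
have := fgv; rewrite rmorphM fg => e; apply: (mulfI g0).
transitivity (g ^+ 2 * (g ^+ 2 * phi v)); last by rewrite e; ring.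
by rewrite mulrA -exprD (exprS _ 3) g3 mulr1.
Qed.

(** For y nonzero, e = y^5 / N^2, so the norm is N^5 (1 + v / N^2)(1 + v' / N^2). Since v' = g^2 v,
    the coefficients are v + v' = - g v and v v' = (g v)^2. At y = 0 the relation leaves e free,
    hence the separate condition. *)
Lemma norm_subst (y e : F) : (y = 0 -> e = 0) -> e * phi y ^+ 2 = y ^+ 3 ->
  norm (v * e + y ^+ 5)
  = norm y ^+ 5 - g * v * norm y ^+ 3 + (g * v) ^+ 2 * norm y.
Proof.
move=> e0 ey.
have [y0|y0] := eqVneq y 0.
  by rewrite (e0 y0) y0 /norm; ring.
have ey' : phi e * y ^+ 2 = phi y ^+ 3 by rewrite -rmorphXn -ey rmorphM rmorphXn phiK.
have N0 : norm y ^+ 2 != 0 by rewrite expf_neq0 // norm_eq0.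
have eN : e = y ^+ 5 / norm y ^+ 2.
  by apply: (mulIf N0); rewrite divfK // exprMn mulrCA ey -exprD.
have eN' : phi e = phi y ^+ 5 / norm y ^+ 2.
  apply: (mulIf N0); rewrite divfK // exprMn mulrA ey' -exprD //.
have gE : g ^+ 2 = - (g + 1) by apply/eqP; rewrite -addr_eq0 addrA eg.
have y'0 : phi y != 0 by rewrite fmorph_eq0.
have gv2 : (g * v) ^+ 2 = - (g + 1) * v ^+ 2 by rewrite exprMn gE.
rewrite {1}/norm rmorphD rmorphM rmorphXn eN' eN phi_v gv2 gE /norm.
by field; rewrite y0 y'0.
Qed.

Lemma subst_exp5_inj (y z e f : F) :
  (y = 0 -> e = 0) -> (z = 0 -> f = 0) ->
  e * phi y ^+ 2 = y ^+ 3 -> f * phi z ^+ 2 = z ^+ 3 ->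
  v * e + y ^+ 5 = v * f + z ^+ 5 -> y ^+ 5 = z ^+ 5.
Proof.
move=> e0 f0 ey fz eG.
have eN : norm y = norm z.
  apply: (@dickson5_inj F phi g (g * v)) => //; first by rewrite mulf_neq0.
  by rewrite -(norm_subst e0 ey) -(norm_subst f0 fz) eG.
have [y0|y0] := eqVneq y 0.
  have /eqP := eN; rewrite y0 /norm mul0r eq_sym norm_eq0 => /eqP ->.
  by rewrite expr0n.
have N0 : norm y ^+ 2 != 0 by rewrite expf_neq0 // norm_eq0.
(* Otherwise v would be fixed by [phi], giving g^2 = 1, hence g = 1, while 1 + 1 + 1 = 1 in
   characteristic 2. *)
have vN0 : v + norm y ^+ 2 != 0.
  apply/eqP => vN.
  have: phi (v + norm y ^+ 2) = 0 by rewrite vN rmorph0.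
  rewrite rmorphD rmorphXn norm_fix phi_v => vN'.
  have: (g ^+ 2 - 1) * v = 0 by rewrite -[RHS](subrr 0) -{1}vN' -vN; ring.
  move/eqP; rewrite mulf_eq0 (negPf v0) orbF => /eqP/subr0_eq g2.
  have g1 : g = 1 by rewrite -g3 exprS g2 mulr1.
  have := eg; rewrite g1 !expr1n -[1 + 1]/(2%:R) two0 add0r; exact/eqP/oner_neq0.
apply: (mulIf vN0).
have subE x h : h * phi x ^+ 2 = x ^+ 3 ->
    (v * h + x ^+ 5) * norm x ^+ 2 = x ^+ 5 * (v + norm x ^+ 2).
  move=> hx; transitivity (v * x ^+ 2 * (h * phi x ^+ 2) + x ^+ 5 * norm x ^+ 2).
    by rewrite /norm; ring.
  by rewrite hx; ring.
by rewrite -(subE _ _ ey) eG eN (subE _ _ fz).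
Qed.

(** This serves the bijectivity of the monomial itself. Taking norms in e y'^2 = y^3 gives N = norm
    e, so y^5 = y^2 e y'^2 = e N^2 depends on e alone. *)
Lemma exp5_inj_of_norm (y z e : F) :
  (y = 0 -> e = 0) -> (z = 0 -> e = 0) ->
  e * phi y ^+ 2 = y ^+ 3 -> e * phi z ^+ 2 = z ^+ 3 -> y ^+ 5 = z ^+ 5.
Proof.
have aux (x : F) : (x = 0 -> e = 0) -> e * phi x ^+ 2 = x ^+ 3 ->
    x ^+ 5 = e * norm e ^+ 2.
  have [->|x0 _ ex] := eqVneq x 0.
    by move=> e0 _; rewrite e0 // mul0r expr0n.
  have eN : norm x = norm e.
    have N0 : norm x ^+ 2 != 0 by rewrite expf_neq0 // norm_eq0.
    apply: (mulIf N0); transitivity (x ^+ 3 * phi (x ^+ 3)).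
      by rewrite rmorphXn /norm; ring.
    by rewrite -ex rmorphM rmorphXn phiK /norm; ring.
  rewrite -eN; transitivity (x ^+ 2 * x ^+ 3); first ring.
  by rewrite -ex /norm; ring.
by move=> y0 z0 /(aux _ y0)-> /(aux _ z0)->.
Qed.

End Substituted.

(** Beyond positivity, d enters only through y^(5d) y'^2 = y^3, so one argument serves both residue
    classes of m. *)
Lemma complete_permutation_monomial (F : finFieldType) (phi : {rmorphism F -> F})
    (g v : F) (d : nat) :
  involutive phi -> 2%:R = 0 :> F -> g ^+ 2 + g + 1 = 0 -> phi g = g ^+ 2 ->
  v != 0 -> phi (g * v) = g * v -> (0 < d)%N -> coprime 5 #|F|.-1 ->
  (forall y, (y ^+ 5) ^+ d * phi y ^+ 2 = y ^+ 3) ->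
  complete_permutation_poly (v *: 'X^d).
Proof.
move=> phiK two0 eg fg v0 fgv d_gt0 cop5 hd.
have exp5_inj : injective (fun x : F => x ^+ 5) by exact: finField_exp_inj.
have [r _ rK] := injF_bij exp5_inj.
have e0 (y : F) : y = 0 -> (y ^+ 5) ^+ d = 0.
  by move->; rewrite -exprM expr0n gtn_eqF // muln_gt0.
split; apply: injF_bij => x z /=; rewrite !hornerE -(rK x) -(rK z).
  move/(mulfI v0) => exz; have hz := hd (r z); rewrite -exz in hz.
  apply: (exp5_inj_of_norm phiK _ _ (hd _) hz); first exact: e0.
  by rewrite exz; apply: e0.
by move/(subst_exp5_inj phiK two0 eg fg v0 fgv); apply=> //; apply: e0.
Qed.

Lemma pFrobenius_iter (R : comNzRingType) (p : nat) (pR : p \in [pchar R]) (n : nat) :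
  exists phi : {rmorphism R -> R}, forall x, phi x = x ^+ (p ^ n)%N.
Proof.
elim: n => [|n [phi phiE]]; first by exists idfun => x; rewrite expr1.
exists (pFrobenius_aut pR \o phi) => x /=.
by rewrite pFrobenius_autE phiE -exprM -expnSr.
Qed.

Theorem theorem8 (m : nat) (F : finFieldType) (beta v : F)
    (hm : (3 <= m)%N) (hodd : odd m) (hF : #|F| = (2 ^ (2 * m))%N)
    (hbeta : 3.-primitive_root beta) (hv : v != 0)
    (htr : rel_trace m (beta * v) = 0 \/ rel_trace m (beta ^+ 2 * v) = 0) :
  ((m = 1 %[mod 4])%N ->
     complete_permutation_poly
       (v *: 'X^((2 ^ (2 * m + 1) - 2 ^ (m + 1) + 1) %/ 5)%N)) /\
  ((m = 3 %[mod 4])%N ->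
     complete_permutation_poly
       (v *: 'X^((2 ^ (2 * m) - 2 ^ (m + 1) + 2) %/ 5)%N)).
Proof.
have pF : 2%N \in [pchar F] by apply: card_finPcharP hF _.
have two0 : 2%:R = 0 :> F := pcharf0 pF.
have QE : #|F| = (2 ^ m * 2 ^ m)%N by rewrite hF mul2n -addnn expnD.
set q := (2 ^ m)%N in QE.
have q_ge8 : (8 <= q)%N by rewrite (leq_pexp2l (m := 2) (n1 := 3)).
(* As 16 is 1 modulo 5, q is 2 or 3 modulo 5 according to m modulo 4. *)
have qm4 : q = (2 ^ (m %% 4) * 16 ^ (m %/ 4))%N.
  by rewrite /q {1}(divn_eq m 4) addnC expnD [(_ * 4)%N]mulnC (expnM 2 4).
have q_mod5 : (q %% 5 = 2 ^ (m %% 4) %% 5)%N.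
  by rewrite qm4 -modnMmr -modnXm exp1n muln1.
have q_mod3 : (q %% 3 = 2)%N.
  by rewrite /q -(odd_double_half m) hodd -mul2n expnD expnM -modnMmr -modnXm exp1n.
have [phi phiE] := pFrobenius_iter pF m; rewrite -/q in phiE.
have phiK : involutive phi.
  by move=> x; rewrite !phiE -exprM -QE expf_card.
(* This bound keeps the natural-number subtractions in both exponents from truncating. *)
have q_le : (q * 8 <= q * q)%N by rewrite leq_pmul2l // /q expn_gt0.
have g3 := prim_expr_order hbeta.
have eb : beta ^+ 2 + beta + 1 = 0.
  apply: (mulfI (x := beta - 1)); last first.
    by rewrite mulr0; transitivity (beta ^+ 3 - 1); [ring | rewrite g3 subrr].
  by have := eq_prim_root_expr hbeta 1 0; rewrite subr_eq0 expr1 expr0 => ->.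
have pb : phi beta = beta ^+ 2 by rewrite phiE -(prim_expr_mod hbeta) q_mod3.
(* In characteristic 2, x + x' = 0 means x' = x. *)
have fix_of_trace (x : F) : rel_trace m x = 0 -> phi x = x.
  rewrite /rel_trace -/q -phiE => /eqP; rewrite addrC addr_eq0 => /eqP->.
  by apply/eqP; rewrite eq_sym -subr_eq0 opprK -mulr2n -mulr_natl two0 mul0r.
have [g [eg fg fgv]] : exists g : F,
    [/\ g ^+ 2 + g + 1 = 0, phi g = g ^+ 2 & phi (g * v) = g * v].
  case: htr => /fix_of_trace fbv; first by exists beta.
  exists (beta ^+ 2); split=> //; last by rewrite rmorphXn pb.
  by rewrite -exprM (exprS _ 3) g3 mulr1 (addrC beta) eb.
(* For odd m, 4^m is 4 modulo 5, so #|F| - 1 is 3 modulo 5. *)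
have cop5 : coprime 5 #|F|.-1.
  rewrite prime_coprime //; apply/negP => /dvdnP[j].
  have -> : #|F| = (4 ^ m)%N by rewrite hF expnM.
  have [k ->] : exists k, (4 ^ m = 5 * k + 4)%N.
    exists (4 ^ m %/ 5)%N; rewrite {1}(divn_eq (4 ^ m) 5) mulnC; congr (_ + _)%N.
    by rewrite -(odd_double_half m) hodd -mul2n expnD expnM -modnMmr -modnXm exp1n.
  lia.
split=> hm4; rewrite hm4 in q_mod5;
  apply: (complete_permutation_monomial phiK two0 eg fg hv fgv) => //.
- rewrite divn_gt0 // !addn1 !expnS -hF QE -/q; lia.
- move=> y; rewrite phiE -!exprM -exprD.
  (* Here 5d = 2 q^2 - 2 q + 1, divisible by 5 because q is 2 modulo 5; then y^(2 #|F| + 1) =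
     y^3. *)
  have -> : (5 * ((2 ^ (2 * m + 1) - 2 ^ (m + 1) + 1) %/ 5) + q * 2
             = #|F| + #|F| + 1)%N.
    rewrite mulnC divnK; first by rewrite !addn1 !expnS -hF QE -/q; lia.
    rewrite !addn1 !expnS -hF QE -/q.
    have [k ->] : exists k, q = (5 * k + 2)%N.
      by exists (q %/ 5)%N; rewrite [LHS](divn_eq q 5) q_mod5 mulnC.
    have -> : ((5 * k + 2) * (5 * k + 2) = 25 * (k * k) + 20 * k + 4)%N by ring.
    by apply/dvdnP; exists (10 * (k * k) + 6 * k + 1)%N; lia.
  by rewrite !exprD expf_card expr1; ring.
- rewrite divn_gt0 // !addn1 !expnS -hF QE -/q; lia.
- move=> y; rewrite phiE -!exprM -exprD.
  (* Here 5d = q^2 - 2 q + 2, divisible by 5 because q is 3 modulo 5; then y^(#|F| + 2) = y^3. *)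
  have -> : (5 * ((2 ^ (2 * m) - 2 ^ (m + 1) + 2) %/ 5) + q * 2 = #|F| + 2)%N.
    rewrite mulnC divnK; first by rewrite !addn1 !expnS -hF QE -/q; lia.
    rewrite !addn1 !expnS -hF QE -/q.
    have [k ->] : exists k, q = (5 * k + 3)%N.
      by exists (q %/ 5)%N; rewrite [LHS](divn_eq q 5) q_mod5 mulnC.
    have -> : ((5 * k + 3) * (5 * k + 3) = 25 * (k * k) + 30 * k + 9)%N by ring.
    by apply/dvdnP; exists (5 * (k * k) + 4 * k + 1)%N; lia.
  by rewrite exprD expf_card -exprS.
Qed.
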